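(* Let $\mathbb{M}^2$ be either the sphere $\mathbb{S}^2$ or the real projective plane $\mathbb{RP}^2$, and let $K$ be a real constant. The only entire solutions $u$ on $\mathbb{M}^2$ to either $$(1+|Du|^2)^2K=1+|Du|^2+\det(D^2u)$$ or $$(1-|Du|^2)^2K=1-|Du|^2-\det(D^2u),\qquad |Du|^2<1,$$ are the constant functions, and $K=1$ necessarily. In particular, if $K\neq 1$, there exist no entire solutions on $\mathbb{M}^2$ to either of the two equations above.
   Context: $\mathbb{S}^2$ and $\mathbb{RP}^2$ carry their standard metrics of constant Gaussian curvature $1$. An entire solution is a smooth function $u\in\mathcal{C}^\infty(\mathbb{M}^2)$ defined on all of $\mathbb{M}^2$ satisfying the equation (and, for the second equation, the condition $|Du|^2<1$) at every point. $Du$ and $D^2u$ are the gradient and the Hessian of $u$ with respect to the metric $\langle\cdot,\cdot\rangle_{\mathbb{M}}$ of $\mathbb{M}^2$, $|Du|^2=\langle Du,Du\rangle_{\mathbb{M}}$, and $\det(D^2u)$ is the determinant of the matrix of $D^2u$ in a local orthonormal frame of $\mathbb{M}^2$. *)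

(* Defs.v *)
From mathcomp Require Import all_boot all_order all_algebra.
From mathcomp Require Import generic_quotient ring.
From mathcomp Require Import all_classical all_reals all_analysis.

Set Implicit Arguments.
Unset Strict Implicit.
Unset Printing Implicit Defensive.

Import Order.TTheory GRing.Theory Num.Theory.
Import numFieldNormedType.Exports.

Local Open Scope classical_set_scope.
Local Open Scope ring_scope.
Local Open Scope quotient_scope.

(* The norm of the normed space 'rV[R]_n is the sup norm, so Euclidean lengths
   are always expressed through this dot product. *)
Definition dotv (R : realType) (n : nat) (v w : 'rV[R]_n) : R :=
  \sum_(i < n) v ord0 i * w ord0 i.

Definition pderiv (R : realType) (V : normedModType R) (i : 'I_2)
    (f : 'rV[R]_2 -> V) (x : 'rV[R]_2) : V :=
  'D_(delta_mx ord0 i) f x.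

(* C^oo on an open set D: every iterated partial derivative of f, including f
   itself, is (Frechet) differentiable at every point of D. *)
Definition smooth_on (R : realType) (D : set 'rV[R]_2) (f : 'rV[R]_2 -> R) :
    Prop :=
  forall (s : seq 'I_2) (x : 'rV[R]_2), D x ->
    differentiable (foldr (fun i g => pderiv i g) f s) x.

(* A surface with a Riemannian metric, presented by an atlas: [param c] is the
   local parametrization attached to the chart c; only its restriction to the
   open set [dom c] is used, and [metric c x] is the matrix (g_ij) of the metric
   in the coordinates of c. *)
Record surface (R : realType) := Surface {
  point :> Type ;
  chart : Type ;
  dom : chart -> set 'rV[R]_2 ;
  param : chart -> 'rV[R]_2 -> point ;
  metric : chart -> 'rV[R]_2 -> 'M[R]_2
}.

Section Calculus.
Variables (R : realType) (M : surface R).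
Implicit Types (u : M -> R) (c : chart M) (x v w : 'rV[R]_2).

Definition local_expr u c (x : 'rV[R]_2) : R := u (param c x).

Definition smooth u : Prop :=
  forall c, smooth_on (dom c) (local_expr u c).

(* Tangent vectors are given by their rows of components in the coordinate
   frame of c. *)
Definition inner c x v w : R := (v *m metric c x *m w^T) ord0 ord0.

Definition grad u c x : 'rV[R]_2 :=
  (\row_i pderiv i (local_expr u c) x) *m invmx (metric c x).

Definition grad_sqr u c x : R := inner c x (grad u c x) (grad u c x).

(* christoffel c x k i j is Gamma^k_ij of the Levi-Civita connection *)
Definition christoffel c x (k i j : 'I_2) : R :=
  2^-1 * \sum_(l < 2) invmx (metric c x) k l *
    (pderiv i (fun y => metric c y j l) x
     + pderiv j (fun y => metric c y i l) x
     - pderiv l (fun y => metric c y i j) x).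

(* D^2u in the coordinate frame *)
Definition hessian u c x : 'M[R]_2 :=
  \matrix_(i, j) (pderiv i (pderiv j (local_expr u c)) x
    - \sum_(k < 2) christoffel c x k i j * pderiv k (local_expr u c) x).

(* The rows of E are two tangent vectors e_0, e_1, orthonormal at param c x. *)
Definition orthonormal_frame c x (E : 'M[R]_2) : Prop :=
  E *m metric c x *m E^T = 1%:M.

(* The matrix (D^2u(e_a, e_b))_ab, whose determinant does not depend on the
   orthonormal frame E; frames exist as the metric is positive definite. *)
Definition hessian_in u c x (E : 'M[R]_2) : 'M[R]_2 :=
  E *m hessian u c x *m E^T.

Definition entire_solution_plus (K : R) u : Prop :=
  smooth u /\
  forall c x, dom c x ->
    forall E, orthonormal_frame c x E ->
      (1 + grad_sqr u c x) ^+ 2 * K =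
        1 + grad_sqr u c x + \det (hessian_in u c x E).

Definition entire_solution_minus (K : R) u : Prop :=
  smooth u /\
  forall c x, dom c x ->
    grad_sqr u c x < 1 /\
    forall E, orthonormal_frame c x E ->
      (1 - grad_sqr u c x) ^+ 2 * K =
        1 - grad_sqr u c x - \det (hessian_in u c x E).

End Calculus.

Section Models.
Variable R : realType.

Definition sphere_point := {p : 'rV[R]_3 | dotv p p == 1}.

Definition orthogonal_mx := {Q : 'M[R]_3 | Q *m Q^T == 1%:M}.

(* The inverse of the stereographic projection from (0,0,-1): it maps the open
   unit disc onto the open hemisphere centred at (0,0,1). *)
Definition stereo (x : 'rV[R]_2) : 'rV[R]_3 :=
  (1 + dotv x x)^-1 *:
    \row_(i < 3) [:: 2 * x ord0 ord0; 2 * x ord0 ord_max; 1 - dotv x x]`_i.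

Definition hemisphere_fun (Q : orthogonal_mx) (x : 'rV[R]_2) : 'rV[R]_3 :=
  stereo x *m val Q.

Lemma dotvE n (v w : 'rV[R]_n) : dotv v w = (v *m w^T) ord0 ord0.
Proof. by rewrite mxE; apply: eq_bigr => i _; rewrite mxE. Qed.

Lemma dotv_ge0 n (v : 'rV[R]_n) : 0 <= dotv v v.
Proof. by apply: sumr_ge0 => i _; rewrite -expr2 sqr_ge0. Qed.

Lemma dotv_orthogonal (Q : orthogonal_mx) (v w : 'rV[R]_3) :
  dotv (v *m val Q) (w *m val Q) = dotv v w.
Proof.
by rewrite !dotvE trmx_mul mulmxA -(mulmxA v) (eqP (valP Q)) mulmx1.
Qed.

Lemma dotv_stereo (x : 'rV[R]_2) : dotv (stereo x) (stereo x) == 1.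
Proof.
have xE : dotv x x = x ord0 ord0 ^+ 2 + x ord0 ord_max ^+ 2.
  rewrite /dotv !big_ord_recl big_ord0 addr0 !expr2.
  by congr (_ + _ * _); congr (x _ _); apply: val_inj.
have : 1 + dotv x x != 0 by rewrite lt0r_neq0 // ltr_pwDl // dotv_ge0.
rewrite /stereo xE => d_neq0.
rewrite /dotv !big_ord_recl big_ord0 !mxE /=.
by apply/eqP; field.
Qed.

Lemma hemisphere_subproof (Q : orthogonal_mx) (x : 'rV[R]_2) :
  dotv (hemisphere_fun Q x) (hemisphere_fun Q x) == 1.
Proof. by rewrite dotv_orthogonal dotv_stereo. Qed.

Definition hemisphere (Q : orthogonal_mx) (x : 'rV[R]_2) : sphere_point :=
  exist _ (hemisphere_fun Q x) (hemisphere_subproof Q x).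

(* The metric induced by the Euclidean metric of R^3 *)
Definition induced_metric (Q : orthogonal_mx) (x : 'rV[R]_2) : 'M[R]_2 :=
  \matrix_(i, j)
    dotv (pderiv i (hemisphere_fun Q) x) (pderiv j (hemisphere_fun Q) x).

Definition open_disc : set 'rV[R]_2 := [set x | dotv x x < 1].

(* The unit sphere, with the atlas of all open hemispheres *)
Definition sphere : surface R :=
  Surface (fun _ => open_disc) hemisphere induced_metric.

Definition antipodal (p q : sphere_point) : bool :=
  (val p == val q) || (val p == - val q).

Lemma antipodal_refl : reflexive antipodal.
Proof. by move=> p; rewrite /antipodal eqxx. Qed.

Lemma antipodal_sym : symmetric antipodal.
Proof.
by move=> p q; rewrite /antipodal eq_sym (eq_sym (val p) (- _)) eqr_oppLR.
Qed.

Lemma antipodal_trans : transitive antipodal.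
Proof.
move=> q p r /orP[] /eqP pq /orP[] /eqP qr; rewrite /antipodal pq qr ?opprK;
by rewrite eqxx ?orbT.
Qed.

Canonical antipodal_equiv :=
  EquivRel antipodal antipodal_refl antipodal_sym antipodal_trans.

Definition projective_point := {eq_quot antipodal_equiv}.

Definition to_projective (p : sphere_point) : projective_point :=
  \pi_{eq_quot antipodal_equiv} p.

(* The quotient of the sphere by the antipodal map, with the metric that makes
   the projection a local isometry; an open hemisphere embeds in it. *)
Definition projective_plane : surface R :=
  Surface (fun _ => open_disc) (fun Q x => to_projective (hemisphere Q x))
    induced_metric.

End Models.

(* Main.v *)
(* Everything is evaluated at centres of charts, where the metric is 4 times the
   identity with vanishing first derivatives: with f the local expression of u
   in the chart of Q in O(3), |Du|^2 = |df(0)|^2 / 4 and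
   det (D^2u) = det (f_ij(0)) / 16.
   At a maximum of u, Du = 0 and det (D^2u) >= 0, so the equations give K >= 1
   and K <= 1 respectively.  As O(3) is compact, the derivative f_0(0), which is
   twice the derivative of u along a unit tangent vector, also has a maximum
   over Q; moving this vector in the two directions of the conformal frame of
   the chart gives f_00(0) = f_10(0) = 0, hence det (D^2u) = 0 there.  The
   equations become (1 + |Du|^2) K = 1 and (1 - |Du|^2) K = 1, which forces
   Du = 0 and K = 1.  The maximal directional derivative of u is thus 0, so u
   is constant.  Functions on the projective plane are pulled back to the
   sphere. *)

Require Import Defs.
From mathcomp Require Import all_boot all_order all_algebra.
From mathcomp Require Import generic_quotient ring lra.
From mathcomp Require Import all_classical all_reals all_analysis.

Set Implicit Arguments.
Unset Strict Implicit.
Unset Printing Implicit Defensive.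

Import Order.TTheory GRing.Theory Num.Theory.
Import numFieldNormedType.Exports.

Local Open Scope classical_set_scope.
Local Open Scope ring_scope.

(** * Calculus *)

Section Calculus.
Variable R : realType.

(** A matrix is the finite sum of its entries times the elementary matrices, so entrywise limits
    suffice. *)
Lemma cvg_mx (T : Type) (F : set_system T) {FF : Filter F} m n
    (f : T -> 'M[R]_(m, n)) (l : 'M[R]_(m, n)) :
  (forall i j, (fun x => f x i j) @ F --> l i j) -> f @ F --> l.
Proof.
move=> fl; rewrite [l]matrix_sum_delta.
rewrite [f](_ : _ = fun x => \sum_i \sum_j f x i j *: delta_mx i j); last first.
  by apply/funext => x; rewrite -matrix_sum_delta.
apply: cvg_big => [|i _]; first exact: add_continuous.
apply: cvg_big => [|j _]; first exact: add_continuous.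
by apply: cvgZr_tmp; exact: fl.
Qed.

Lemma differentiable_rV (V : normedModType R) n (f : V -> 'rV[R]_n) x :
  (forall i, differentiable (fun y => f y ord0 i) x) -> differentiable f x.
Proof.
move=> df.
rewrite [f](_ : _ = \sum_(i < n) (fun y => f y ord0 i *: delta_mx ord0 i)).
  by apply: differentiable_sum => i; apply: differentiableZl; exact: df.
by apply/funext => y; rewrite fct_sumE [LHS]row_sum_delta.
Qed.

Lemma diff_pderiv (f : 'rV[R]_2 -> R) x w : differentiable f x ->
  'd f x w = \sum_(i < 2) pderiv i f x * w ord0 i.
Proof.
move=> df; rewrite [in LHS](row_sum_delta w) linear_sum; apply: eq_bigr => i _.
by rewrite linearZ /= mulrC /pderiv deriveE.
Qed.

(** At the maximum [df 0 = 0]. If [c] were positive, [df] would be positive just to the right of 0,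
    and the mean value theorem would give [f e > f 0] for some small [e > 0]. *)
Lemma second_derivative_le0 (f df : R -> R) (c : R) :
  (forall t : R, t \in `]-1, 1[ -> is_derive t 1 f (df t)) ->
  (forall t : R, t \in `]-1, 1[ -> f t <= f 0) ->
  is_derive (0 : R) 1 df c -> c <= 0.
Proof.
move=> fdf fmax dfc; rewrite leNgt; apply/negP => c0.
have in0 : (0 : R) \in `]-1, 1[ by rewrite in_itv /= ltrN10 ltr01.
have f'0 : is_derive (0 : R) 1 f 0.
  by apply: (@derive1_at_max R f (-1) 1 0) => [|t /fdf[]|//|//]; first lra.
have df0 : df 0 = 0.
  by have [_ <-] := fdf _ in0; case: f'0.
have [dfd dfE] := dfc.
have : (fun h : R => h^-1 *: (df (h *: 1 + 0) - df 0)) @ 0^' --> c.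
  by rewrite -dfE; exact: dfd.
move/cvgrPdist_lt/(_ _ c0) => [d /= d0 dP].
(* Below [d], where the difference quotient of [df] is positive, and below 1, where the maximality
   of [f 0] applies. *)
pose e := Num.min (d / 2) (1 / 2).
have e0 : 0 < e by rewrite lt_min !divr_gt0.
have ed : e < d.
  by rewrite gt_min; apply/orP; left; lra.
have e1 : e < 1.
  by rewrite gt_min; apply/orP; right; lra.
have pos t : 0 < t -> t < d -> 0 < df t.
  move=> t0 td; have := dP t; rewrite /ball_ /= sub0r normrN gtr0_norm //.
  move=> /(_ td (lt0r_neq0 t0)); rewrite df0 subr0 addr0 [_ *: 1]mulr1.
  move=> /ltr_normlW; rewrite ltrBlDr -ltrBlDl subrr [_ *: _]mulrC.
  by rewrite pmulr_lgt0 // invr_gt0.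
have fc t : t \in `]-1, 1[ -> {for t, continuous f}.
  move=> /fdf[fd _]; apply: differentiable_continuous.
  exact/derivable1_diffP.
have fMVT t : t \in `]0, e[ -> is_derive t 1 f (df t).
  rewrite in_itv /= => /andP[t0 te]; apply: fdf; rewrite in_itv /=.
  by apply/andP; split; lra.
have fe : f e <= f 0 by apply: fmax; rewrite in_itv /=; apply/andP; split; lra.
have cf : {within `[0, e], continuous f}.
  apply: continuous_in_subspaceT => t; rewrite inE /= in_itv /= => /andP[t0 te].
  by apply: fc; rewrite in_itv /=; apply/andP; split; lra.
have [z + fez] := MVT e0 fMVT cf.
rewrite in_itv /= => /andP[z0 ze].
have : 0 < df z * (e - 0) by rewrite mulr_gt0 ?subr0 // pos // (lt_trans ze).
by rewrite -fez subr_gt0 ltNge fe.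
Qed.

(* b and b' are kept apart: applied to second partial derivatives, this does not
   need their symmetry. *)
Lemma nsd_det_ge0 (a b b' c : R) :
  (forall s t, a * s ^+ 2 + (b + b') * s * t + c * t ^+ 2 <= 0) ->
  0 <= a * c - b * b'.
Proof.
move=> h.
have a0 : a <= 0 by have := h 1 0; lra.
have c0 : c <= 0 by have := h 0 1; lra.
(* Enough because [4 * b * b' <= (b + b') ^+ 2]. *)
suff : (b + b') ^+ 2 <= 4 * (a * c) by have := sqr_ge0 (b - b'); nra.
move: a0; rewrite le_eqVlt => /orP[/eqP a0|a0].
  (* With [a = 0] the form takes the value [(b + b') ^+ 2] at this point. *)
  by have := h (1 - c) (b + b'); rewrite a0; nra.
have e : a * (4 * (a * c) - (b + b') ^+ 2) <= 0.
  by have := h (b + b') (- 2 * a); congr (_ <= _); ring.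
by rewrite -subr_ge0 -(nmulr_rle0 _ a0).
Qed.

End Calculus.

(** * Stereographic coordinates *)

Local Notation ord_mid := (@Ordinal 3 1 isT).

Lemma sum_ord2 (V : nmodType) (F : 'I_2 -> V) :
  \sum_(i < 2) F i = F ord0 + F ord_max.
Proof.
by rewrite !big_ord_recl big_ord0 addr0; congr (_ + F _); exact: val_inj.
Qed.

Lemma sum_ord3 (V : nmodType) (F : 'I_3 -> V) :
  \sum_(i < 3) F i = F ord0 + F ord_mid + F ord_max.
Proof.
rewrite !big_ord_recl big_ord0 addr0 addrA.
by congr (_ + F _ + F _); exact: val_inj.
Qed.

Lemma ord2P (P : 'I_2 -> Prop) : P ord0 -> P ord_max -> forall i, P i.
Proof.
move=> P0 P1 [[|[|//]] hi].
  by rewrite (_ : Ordinal hi = ord0) //; exact: val_inj.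
by rewrite (_ : Ordinal hi = ord_max) //; exact: val_inj.
Qed.

Lemma ord3P (P : 'I_3 -> Prop) :
  P ord0 -> P ord_mid -> P ord_max -> forall i, P i.
Proof.
move=> P0 P1 P2 [[|[|[|//]]] hi].
- by rewrite (_ : Ordinal hi = ord0) //; exact: val_inj.
- by rewrite (_ : Ordinal hi = ord_mid) //; exact: val_inj.
- by rewrite (_ : Ordinal hi = ord_max) //; exact: val_inj.
Qed.

Section Stereo.
Variable R : realType.
Implicit Types (x y v : 'rV[R]_2) (z : 'rV[R]_3) (A Q : orthogonal_mx R).

Lemma dotv2 x : dotv x x = x ord0 ord0 ^+ 2 + x ord0 ord_max ^+ 2.
Proof. by rewrite /dotv sum_ord2. Qed.

Lemma dotv3 z : dotv z z =
  z ord0 ord0 ^+ 2 + z ord0 ord_mid ^+ 2 + z ord0 ord_max ^+ 2.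
Proof. by rewrite /dotv sum_ord3. Qed.

Lemma dotv0 : dotv (0 : 'rV[R]_2) 0 = 0.
Proof. by rewrite dotv2 !mxE; ring. Qed.

Lemma stereo_den_neq0 x : 1 + dotv x x != 0.
Proof. by rewrite lt0r_neq0 // ltr_pwDl // dotv_ge0. Qed.

Let den_neq0 x : 1 + (x ord0 ord0 ^+ 2 + x ord0 ord_max ^+ 2) != 0.
Proof. by rewrite -dotv2 stereo_den_neq0. Qed.

(** Stereographic projection from (0,0,-1); the index is widened to pick the first two coordinates.
    The pole itself gets the meaningless value 0. *)
Definition stereo_inv z : 'rV[R]_2 :=
  \row_i (z ord0 (widen_ord (leqnSn 2) i) / (1 + z ord0 ord_max)).

Let widen0 : widen_ord (leqnSn 2) ord0 = ord0 :> 'I_3.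
Proof. exact: val_inj. Qed.
Let widen1 : widen_ord (leqnSn 2) ord_max = ord_mid :> 'I_3.
Proof. exact: val_inj. Qed.

Lemma stereo_invK z : dotv z z == 1 -> 1 + z ord0 ord_max != 0 ->
  stereo (stereo_inv z) = z.
Proof.
rewrite dotv3 => /eqP z1 z2.
have e : 1 + dotv (stereo_inv z) (stereo_inv z) = 2 / (1 + z ord0 ord_max).
  rewrite dotv2 !mxE widen0 widen1.
  apply/eqP; rewrite -subr_eq0.
  (* The difference of the two sides is a multiple of [|z|^2 - 1]. *)
  have -> : 1 + ((z ord0 ord0 / (1 + z ord0 ord_max)) ^+ 2 +
     (z ord0 ord_mid / (1 + z ord0 ord_max)) ^+ 2) - 2 / (1 + z ord0 ord_max)
     = (z ord0 ord0 ^+ 2 + z ord0 ord_mid ^+ 2 + z ord0 ord_max ^+ 2 - 1)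
       / (1 + z ord0 ord_max) ^+ 2 by field.
  by rewrite z1 subrr mul0r.
have e2 : 1 - dotv (stereo_inv z) (stereo_inv z) =
    2 * z ord0 ord_max / (1 + z ord0 ord_max).
  by move: e => /(canRL (addKr _)) ->; field.
apply/rowP; rewrite /stereo e e2; apply: ord3P; rewrite !mxE /= ?widen0 ?widen1.
- by field.
- by field.
- by field.
Qed.

(** In this form the only denominator to differentiate is [1 + dotv x x], and the last coordinate
    has a constant numerator. *)
Lemma stereoE x : stereo x =
  \row_(i < 3) [:: 2 * x ord0 ord0 / (1 + dotv x x);
                   2 * x ord0 ord_max / (1 + dotv x x);
                   2 / (1 + dotv x x) - 1]`_i.
Proof.
have := stereo_den_neq0 x => h.
by apply/rowP; apply: ord3P; rewrite !mxE /=; field.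
Qed.

Lemma stereoK x : stereo_inv (stereo x) = x.
Proof.
have h := stereo_den_neq0 x.
rewrite stereoE; apply/rowP; apply: ord2P; rewrite !mxE ?widen0 ?widen1 /=;
  field; rewrite h /= (_ : _ + _ = 2) ?pnatr_eq0 //; ring.
Qed.

(** The derivative of [stereo] at [x] along [v]. Here [s] is the conformal factor, whose own
    derivative along [v] is [- s ^+ 2 * dotv x v]. *)
Definition dstereo x v : 'rV[R]_3 :=
  let s := 2 / (1 + dotv x x) in
  \row_(i < 3) [:: s * v ord0 ord0 - s ^+ 2 * dotv x v * x ord0 ord0;
                   s * v ord0 ord_max - s ^+ 2 * dotv x v * x ord0 ord_max;
                   - s ^+ 2 * dotv x v]`_i.

Lemma is_derive_coord x v i : is_derive x v (fun y => y ord0 i) (v ord0 i).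
Proof.
have d : derivable (fun y : 'rV[R]_2 => y) x v by [].
apply: DeriveDef; first by move/derivable_mxP: d.
have := derive_mx d; rewrite derive_id.
move=> /(congr1 (fun M : 'rV[R]_2 => M ord0 i)).
by rewrite mxE => ->.
Qed.

Lemma differentiable_stereo x k : differentiable (fun y => stereo y ord0 k) x.
Proof.
have c (i : 'I_2) : differentiable (fun y : 'rV[R]_2 => y ord0 i) x.
  exact: differentiable_coord.
have s : differentiable (fun y : 'rV[R]_2 => 1 + dotv y y) x.
  rewrite [X in differentiable X _](_ : _ = cst 1 +
    ((fun y => y ord0 ord0) * (fun y => y ord0 ord0) +
     (fun y => y ord0 ord_max) * (fun y => y ord0 ord_max))); last first.
    by apply/funext => y; rewrite dotv2 !expr2.
  apply: differentiableD; first exact: differentiable_cst.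
  by apply: differentiableD; apply: differentiableM; exact: c.
have si := differentiableV s (stereo_den_neq0 x).
move: k; apply: ord3P.
- rewrite [X in differentiable X _](_ : _ = (cst 2 * (fun y => y ord0 ord0)) *
    (fun y => (1 + dotv y y)^-1)); last first.
    by apply/funext => y; rewrite stereoE !mxE.
  by apply: differentiableM => //; apply: differentiableM.
- rewrite [X in differentiable X _](_ : _ = (cst 2 * (fun y => y ord0 ord_max)) *
    (fun y => (1 + dotv y y)^-1)); last first.
    by apply/funext => y; rewrite stereoE !mxE.
  by apply: differentiableM => //; apply: differentiableM.
- rewrite [X in differentiable X _](_ : _ = cst 2 *
    (fun y => (1 + dotv y y)^-1) - cst 1); last first.
    by apply/funext => y; rewrite stereoE !mxE.
  by apply: differentiableB => //; apply: differentiableM.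
Qed.

Lemma is_derive_den x v :
  is_derive x v (fun y => (1 + dotv y y)^-1)
    (- 2 * dotv x v / (1 + dotv x x) ^+ 2).
Proof.
have c i := is_derive_coord x v i.
have h := stereo_den_neq0 x.
have s : is_derive x v (fun y : 'rV[R]_2 => 1 + dotv y y) (2 * dotv x v).
  rewrite [X in is_derive _ _ X _](_ : _ = cst 1 +
    ((fun y => y ord0 ord0) * (fun y => y ord0 ord0) +
     (fun y => y ord0 ord_max) * (fun y => y ord0 ord_max))); last first.
    by apply/funext => y; rewrite dotv2 !expr2.
  have d2 i := is_deriveM (c i) (c i).
  have d := is_deriveD (is_derive_cst (1 : R) x v)
    (is_deriveD (d2 ord0) (d2 ord_max)).
  refine (is_derive_eq d _).
  by rewrite /dotv sum_ord2 /GRing.scale /=; ring.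
have [sd sE] := s.
apply: DeriveDef; first exact: derivableV.
by rewrite deriveV // sE /GRing.scale /=; field.
Qed.

Lemma is_derive_stereo x v k :
  is_derive x v (fun y => stereo y ord0 k) (dstereo x v ord0 k).
Proof.
have c i := is_derive_coord x v i.
have s := is_derive_den x v.
have h := stereo_den_neq0 x.
move: k; apply: ord3P.
- rewrite [X in is_derive _ _ X _](_ : _ = (cst 2 * (fun y => y ord0 ord0)) *
    (fun y => (1 + dotv y y)^-1)); last first.
    by apply/funext => y; rewrite stereoE !mxE.
  by apply: is_derive_eq; rewrite !mxE /GRing.scale !fctE /=; field.
- rewrite [X in is_derive _ _ X](_ : _ = (cst 2 * (fun y => y ord0 ord_max)) *
    (fun y => (1 + dotv y y)^-1)); last first.
    by apply/funext => y; rewrite stereoE !mxE.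
  by apply: is_derive_eq; rewrite !mxE /GRing.scale !fctE /=; field.
- rewrite [X in is_derive _ _ X](_ : _ = cst 2 *
    (fun y => (1 + dotv y y)^-1) - cst 1); last first.
    by apply/funext => y; rewrite stereoE !mxE.
  by apply: is_derive_eq; rewrite !mxE /GRing.scale !fctE /=; field.
Qed.

Lemma stereo_mulmxE (A : 'M[R]_3) j : (fun y => (stereo y *m A) ord0 j) =
  \sum_(k < 3) (fun y => stereo y ord0 k) * cst (A k j).
Proof. by apply/funext => y; rewrite mxE fct_sumE. Qed.

Lemma is_derive_stereo_mulmx (A : 'M[R]_3) x v j :
  is_derive x v (fun y => (stereo y *m A) ord0 j) ((dstereo x v *m A) ord0 j).
Proof.
rewrite stereo_mulmxE mxE; apply: is_derive_sum => k.
have := is_derive_stereo x v k => dk.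
by apply: is_derive_eq; rewrite scaler0 add0r [_ *: _]mulrC.
Qed.

Lemma differentiable_stereo_mulmx (A : 'M[R]_3) x j :
  differentiable (fun y => (stereo y *m A) ord0 j) x.
Proof.
rewrite stereo_mulmxE; apply: differentiable_sum => k.
by apply: differentiableM => //; exact: differentiable_stereo.
Qed.

Lemma pderiv_hemisphere_fun Q x i :
  pderiv i (hemisphere_fun Q) x = dstereo x (delta_mx ord0 i) *m val Q.
Proof.
have d : derivable (hemisphere_fun Q) x (delta_mx ord0 i).
  apply/derivable_mxP => k l; rewrite (ord1 k).
  by have [] := is_derive_stereo_mulmx (val Q) x (delta_mx ord0 i) l.
rewrite /pderiv derive_mx //; apply/matrixP => k l; rewrite (ord1 k) mxE.
by have [_ ->] := is_derive_stereo_mulmx (val Q) x (delta_mx ord0 i) l.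
Qed.

(** Conformality of stereographic projection. *)
Lemma dotv_dstereo x v w :
  dotv (dstereo x v) (dstereo x w) = (2 / (1 + dotv x x)) ^+ 2 * dotv v w.
Proof.
have h := den_neq0 x.
rewrite {1}/dotv sum_ord3 !mxE /= dotv2 /dotv !sum_ord2; field.
by [].
Qed.

Lemma induced_metricE Q x :
  induced_metric Q x = ((2 / (1 + dotv x x)) ^+ 2)%:M.
Proof.
apply/matrixP => i j; rewrite !mxE !pderiv_hemisphere_fun dotv_orthogonal.
rewrite dotv_dstereo -[RHS]mulr_natr; congr (_ * _).
by rewrite /dotv sum_ord2 !mxE; move: i; apply: ord2P; move: j; apply: ord2P;
  rewrite /= ?mulr1 ?mulr0 ?addr0 ?add0r.
Qed.

(** The metric depends on [dotv y y] alone, whose differential vanishes at 0. This makes the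
    Christoffel symbols vanish at the centre of every chart. *)
Lemma pderiv_metric0 Q i j k :
  pderiv i (fun y => induced_metric Q y j k) 0 = 0.
Proof.
have s := is_derive_den 0 (delta_mx ord0 i).
have e : (fun y => induced_metric Q y j k) =
  cst (4 * (j == k)%:R) * ((fun y => (1 + dotv y y)^-1) *
   (fun y => (1 + dotv y y)^-1)).
  by apply/funext => y; rewrite induced_metricE mxE -mulr_natr /=;
    have := stereo_den_neq0 y => h; rewrite !fctE /=; field.
by rewrite /pderiv e derive_val /dotv !sum_ord2 !mxE /GRing.scale !fctE /=
  !(mul0r, mulr0, addr0).
Qed.

End Stereo.

(** * The orthogonal group *)

Section Orthogonal.
Variable R : realType.
Implicit Types (x y v : 'rV[R]_2) (z : 'rV[R]_3) (A Q : orthogonal_mx R).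

Lemma orthogonal_mul_subproof A Q :
  (val A *m val Q) *m (val A *m val Q)^T == 1%:M.
Proof.
by rewrite trmx_mul mulmxA -(mulmxA (val A)) (eqP (valP Q)) mulmx1 (valP A).
Qed.

Definition orthogonal_mul A Q : orthogonal_mx R :=
  exist _ (val A *m val Q) (orthogonal_mul_subproof A Q).

Lemma mulTmx_orthogonal Q : (val Q)^T *m val Q = 1%:M.
Proof. by apply: mulmx1C; exact/eqP/(valP Q). Qed.

Lemma orthogonal_tr_subproof Q : (val Q)^T *m (val Q)^T^T == 1%:M.
Proof. by rewrite trmxK mulTmx_orthogonal. Qed.

Definition orthogonal_tr Q : orthogonal_mx R :=
  exist _ (val Q)^T (orthogonal_tr_subproof Q).

Lemma orthogonal_trK A Q :
  orthogonal_mul (orthogonal_tr A) (orthogonal_mul A Q) = Q.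
Proof. by apply: val_inj => /=; rewrite mulmxA mulTmx_orthogonal mul1mx. Qed.

Lemma orthogonal_mulrK A Q :
  orthogonal_mul (orthogonal_mul A (orthogonal_tr Q)) Q = A.
Proof.
by apply: val_inj => /=; rewrite -mulmxA mulTmx_orthogonal mulmx1.
Qed.

Lemma compact_orthogonal : compact [set M : 'M[R]_3 | M *m M^T = 1%:M].
Proof.
have vec_cont : continuous (vec_mx : 'rV[R]_(3 * 3) -> 'M[R]_3).
  move=> w; apply: (cvg_mx (F := nbhs w)) => i j.
  by under eq_cvg do rewrite mxE; rewrite mxE; exact: coord_continuous.
(* The group is flattened into row vectors of length 9, where closed bounded sets are compact. *)
pose C := [set w : 'rV[R]_(3 * 3) | vec_mx w *m (vec_mx w)^T = 1%:M].
have -> : [set M : 'M[R]_3 | M *m M^T = 1%:M] = vec_mx @` C.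
  apply/seteqP; split => [M /= MM|_ [w /= ww <-] //].
  by exists (mxvec M); rewrite /C /= mxvecK.
apply: continuous_compact; first exact: continuous_subspaceT.
apply: bounded_closed_compact.
  exists 1; split => // m m1 w /= ww.
  apply: le_trans (ltW m1); rewrite [leLHS]/Num.Def.normr /= mx_normrE.
  apply: bigmax_le => // -[i k] _ /=; rewrite (ord1 i).
  have [a [b ->]] : exists a b, w ord0 k = vec_mx w a b.
    by case/mxvec_indexP: k => a b; exists a, b; rewrite mxE.
  (* The diagonal entry says that row [a] is a unit vector, so each of its entries is at most 1 in
     absolute value. *)
  have := congr1 (fun M : 'M[R]_3 => M a a) ww; rewrite !mxE eqxx mulr1n.
  under eq_bigr do rewrite [_^T _ _]mxE -expr2.
  move=> s1; rewrite -(@expr_le1 R 2) // -normrX ger0_norm ?sqr_ge0 //.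
  rewrite -[leRHS]s1 (bigD1 b) //= [vec_mx w a b]mxE lerDl.
  by apply: sumr_ge0 => j _; exact: sqr_ge0.
have mul_cont : continuous (fun w : 'rV[R]_(3 * 3) =>
    vec_mx w *m (vec_mx w)^T).
  move=> w; apply: (cvg_mx (F := nbhs w)) => i j.
  under eq_cvg do rewrite mxE; rewrite mxE.
  apply: cvg_big => [|k _]; first exact: add_continuous.
  under eq_cvg do rewrite !mxE; rewrite !mxE.
  by apply: cvgM; exact: coord_continuous.
have /continuous_closedP /(_ [set 1%:M]) := mul_cont.
by apply; exact/accessible_closed_set1/hausdorff_accessible/norm_hausdorff.
Qed.

(* The hypothesis expresses the continuity of g at Q, in terms of M = A Q^T. *)
Lemma orthogonal_max (g : orthogonal_mx R -> R) :
  (forall Q, exists2 g0 : 'M[R]_3 -> R, {for 1%:M, continuous g0} &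
     \forall M \near (1%:M : 'M[R]_3),
       forall A, val A = M -> g (orthogonal_mul A Q) = g0 M) ->
  exists Q, forall A, g A <= g Q.
Proof.
move=> gP.
(* The extreme value theorem is applied on a subset of the matrix space, so [g] is extended to all
   matrices; the value 0 off the group is arbitrary. *)
pose G (M : 'M[R]_3) := if insub M is Some A then g A else 0.
have GE A : G (val A) = g A by rewrite /G valK.
have [||M] := @compact_EVT_max _ R G _ _ compact_orthogonal.
- by exists 1%:M; rewrite /= trmx1 mulmx1.
- apply/subspace_continuousP => M0 /= /eqP M0P.
  pose Q0 : orthogonal_mx R := exist _ M0 M0P.
  have [g0 cg0 gg0] := gP Q0.
  (* An orthogonal [M] near [M0] is [A *m M0] with [A = M *m M0^T] near 1, so there
     [G M = g0 (M *m M0^T)]. *)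
  have mc : (fun M : 'M[R]_3 => M *m M0^T) @ M0 --> (1%:M : 'M[R]_3).
    rewrite -(eqP M0P); apply: (cvg_mx (F := nbhs M0)) => i j.
    under eq_cvg do rewrite mxE; rewrite mxE.
    apply: cvg_big => [|k _]; first exact: add_continuous.
    by apply: cvgM; [exact: coord_continuous | exact: cvg_cst].
  have gE : G M0 = g0 1%:M.
    have := nbhs_singleton gg0 (orthogonal_mul Q0 (orthogonal_tr Q0)).
    rewrite (GE Q0) => <-.
      by rewrite orthogonal_mulrK.
    exact/eqP.
  have -> : nbhs (G M0) = nbhs (g0 1%:M) by rewrite gE.
  apply: cvg_trans (cvg_within_filter _ (cvg_comp _ _ mc cg0)).
  have nr : nbhs (M0 : 'M[R]_3) [set M : 'M[R]_3 | forall A,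
      val A = M *m M0^T -> g (orthogonal_mul A Q0) = g0 (M *m M0^T)] :=
    mc _ gg0.
  apply: near_eq_cvg; apply: filterS nr => M h /eqP MP.
  pose Q : orthogonal_mx R := exist _ M MP.
  have := h (orthogonal_mul Q (orthogonal_tr Q0)) erefl.
  by rewrite orthogonal_mulrK => gQ; exact: etrans (esym gQ) (esym (GE Q)).
rewrite inE => /= /eqP MP Mmax; exists (exist _ M MP) => A.
rewrite -GE -(GE (exist _ M MP)); apply: Mmax; rewrite inE /=.
exact/eqP/(valP A).
Qed.

End Orthogonal.

(** * Changes of charts *)

Section Frame.
Variable R : realType.
Implicit Types (x y v : 'rV[R]_2) (z : 'rV[R]_3) (A Q : orthogonal_mx R).

(* Row 2 is n = stereo x; rows 0 and 1 are the unit tangent vectors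
   (1 + |x|^2) / 2 times the partial derivatives of stereo at x, that is,
   e_i - x_i (n + e_2). *)
Definition frame_mx x : 'M[R]_3 :=
  let s := 2 / (1 + dotv x x) in
  let a := x ord0 ord0 in
  let b := x ord0 ord_max in
  \matrix_(i < 3, j < 3)
    (nth [::] [:: [:: 1 - s * a ^+ 2; - (s * a * b); - (s * a)];
                  [:: - (s * a * b); 1 - s * b ^+ 2; - (s * b)];
                  [:: s * a; s * b; s - 1]] i)`_j.

Lemma frame_subproof x : frame_mx x *m (frame_mx x)^T == 1%:M.
Proof.
have h := stereo_den_neq0 x; rewrite dotv2 in h.
apply/eqP/matrixP => i j; move: i; apply: ord3P; move: j; apply: ord3P;
  rewrite !mxE !sum_ord3 !mxE /= dotv2; field => //.
Qed.

Definition frame x : orthogonal_mx R := exist _ (frame_mx x) (frame_subproof x).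

Lemma stereo0 : stereo 0 = delta_mx ord0 ord_max :> 'rV[R]_3.
Proof.
by rewrite stereoE dotv0 addr0 !divr1; apply/rowP; apply: ord3P;
  rewrite !mxE /=; ring.
Qed.

Lemma stereo0_mul (A : 'M[R]_3) : stereo 0 *m A = row ord_max A.
Proof. by rewrite stereo0 -rowE. Qed.

(** Hence the chart [orthogonal_mul (frame x) Q] is centred at the point with coordinates [x] in the
    chart [Q]. *)
Lemma stereo0_frame x : stereo 0 *m val (frame x) = stereo x.
Proof.
apply/rowP => j; rewrite stereo0_mul mxE stereoE.
by move: j; apply: ord3P; rewrite !mxE /=; ring.
Qed.

(** The change of coordinates from the chart [orthogonal_mul A Q] to the chart [Q]; it is the same
    for all [Q]. *)
Definition transition A y := stereo_inv (stereo y *m val A).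

Lemma differentiable_transition A x :
  1 + (stereo x *m val A) ord0 ord_max != 0 ->
  differentiable (transition A) x.
Proof.
move=> h; apply: differentiable_rV => i.
rewrite [X in differentiable X _](_ : _ =
  (fun y => (stereo y *m val A) ord0 (widen_ord (leqnSn 2) i)) *
  (fun y => (1 + (stereo y *m val A) ord0 ord_max)^-1)); last first.
  by apply/funext => y; rewrite [LHS]mxE.
apply: differentiableM; first exact: differentiable_stereo_mulmx.
apply: differentiableV => //; apply: differentiableD => //.
exact: differentiable_stereo_mulmx.
Qed.

Lemma near_den A x : 1 + (stereo x *m val A) ord0 ord_max != 0 ->
  \forall y \near x, 1 + (stereo y *m val A) ord0 ord_max != 0.
Proof.
move=> h.
have c : {for x, continuous (fun y => 1 + (stereo y *m val A) ord0 ord_max)}.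
  apply: (@cvgD _ _ _ (nbhs x)); first exact: cvg_cst.
  exact/differentiable_continuous/differentiable_stereo_mulmx.
exact: cvgr_neq0 c h.
Qed.

(** The last coordinate of [stereo x] is [2 / (1 + dotv x x) - 1], positive exactly when
    [dotv x x < 1]. *)
Lemma open_disc_stereo_inv z : dotv z z == 1 -> 0 < z ord0 ord_max ->
  open_disc (stereo_inv z).
Proof.
move=> z1 z2; have zn : 1 + z ord0 ord_max != 0 by lra.
rewrite /open_disc /=.
have := congr1 (fun w : 'rV[R]_3 => w ord0 ord_max) (stereo_invK z1 zn).
rewrite stereoE mxE /= => e.
have : 1 < 2 / (1 + dotv (stereo_inv z) (stereo_inv z)) by lra.
have h : 0 < 1 + dotv (stereo_inv z) (stereo_inv z).
  by rewrite ltr_pwDl // dotv_ge0.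
by rewrite ltr_pdivlMr //; lra.
Qed.

Lemma transition0 A : transition A 0 = stereo_inv (row ord_max (val A)).
Proof. by rewrite /transition stereo0_mul. Qed.

Lemma transition0_disc A : 0 < val A ord_max ord_max ->
  open_disc (transition A 0).
Proof.
move=> h; rewrite /transition; apply: open_disc_stereo_inv; 
  first exact: hemisphere_subproof A 0.
by rewrite stereo0_mul mxE.
Qed.

Lemma transition0_frame x : transition (frame x) 0 = x.
Proof. by rewrite /transition stereo0_frame stereoK. Qed.

(* The first partial derivative at 0 of the transition map of M. *)
Definition dtransition (M : 'M[R]_3) (i : 'I_2) : R :=
  let j := widen_ord (leqnSn 2) i in
  2 * (M ord0 j / (1 + M ord_max ord_max)
       - M ord_max j * M ord0 ord_max / (1 + M ord_max ord_max) ^+ 2).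

Lemma dstereo0_mul (M : 'M[R]_3) j :
  (dstereo 0 (delta_mx ord0 ord0) *m M) ord0 j = 2 * M ord0 j.
Proof.
rewrite mxE sum_ord3 /dstereo dotv0 addr0 !divr1 /dotv !sum_ord2 !mxE /=.
by ring.
Qed.

Lemma is_derive_transition A i : 1 + val A ord_max ord_max != 0 ->
  is_derive 0 (delta_mx ord0 ord0) (fun y => transition A y ord0 i)
    (dtransition (val A) i).
Proof.
set j := widen_ord (leqnSn 2) i => h.
have d k := is_derive_stereo_mulmx (val A) 0 (delta_mx ord0 ord0) k.
have den : is_derive 0 (delta_mx ord0 ord0)
    (cst 1 + fun y => (stereo y *m val A) ord0 ord_max)
    (2 * val A ord0 ord_max).
  by apply: is_derive_eq; rewrite add0r dstereo0_mul.
have inv : is_derive 0 (delta_mx ord0 ord0)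
    (fun y => (1 + (stereo y *m val A) ord0 ord_max)^-1)
    (- 2 * val A ord0 ord_max / (1 + val A ord_max ord_max) ^+ 2).
  have [dd dE] := den.
  have h0 : (cst 1 + fun y => (stereo y *m val A) ord0 ord_max) 0 != 0.
    by rewrite fctE stereo0_mul mxE.
  apply: DeriveDef; first exact: derivableV dd.
  rewrite (deriveV h0 dd) dE /= fctE stereo0_mul mxE /GRing.scale /=; field.
  exact: h.
rewrite [X in is_derive _ _ X _](_ : _ =
  (fun y => (stereo y *m val A) ord0 j) *
  (fun y => (1 + (stereo y *m val A) ord0 ord_max)^-1)); last first.
  by apply/funext => y; rewrite [LHS]mxE.
have dj := d j.
apply: is_derive_eq.
rewrite dstereo0_mul ?fctE stereo0_mul [row _ _ _ _]mxE [row _ _ _ _]mxE.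
rewrite /GRing.scale /= /dtransition -/j; field.
exact: h.
Qed.

(** Row 0 of the frame is the normalized first partial derivative of [stereo] at [x]; the factor is
    the ratio of the conformal factors 2 at the centre and [2 / (1 + dotv x x)] at [x]. *)
Lemma dtransition_frame x i :
  dtransition (frame_mx x) i = (1 + dotv x x) * (i == ord0)%:R.
Proof.
have h := stereo_den_neq0 x; rewrite dotv2 in h.
rewrite /dtransition !mxE; move: i; apply: ord2P; rewrite /= dotv2; field;
  rewrite h /= (_ : _ + _ = 2) ?pnatr_eq0 //; ring.
Qed.

End Frame.

(** * Functions on the sphere *)

Lemma is_derive_ray (R : realType) n (f : 'rV[R]_n -> R) w t d :
  is_derive (t *: w) w f d -> is_derive t 1 (fun s : R => f (s *: w)) d.
Proof.
have e : (fun h : R => h^-1 *: (f ((h *: 1 + t) *: w) - f (t *: w))) =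
    (fun h => h^-1 *: (f (h *: w + t *: w) - f (t *: w))).
  by apply/funext => h; rewrite [h *: 1]mulr1 scalerDl.
by move=> [fd fE]; apply: DeriveDef; rewrite /derivable /derive /= e.
Qed.

(** By homogeneity the sign of a quadratic form on the unit disc determines it everywhere. *)
Lemma nsd_disc_det_ge0 (R : realType) (H : 'I_2 -> 'I_2 -> R) :
  (forall w : 'rV[R]_2, dotv w w < 1 ->
     \sum_(i < 2) (\sum_(j < 2) H j i * w ord0 j) * w ord0 i <= 0) ->
  0 <= H ord0 ord0 * H ord_max ord_max - H ord0 ord_max * H ord_max ord0.
Proof.
move=> Hle0; apply: nsd_det_ge0 => s t.
pose w : 'rV[R]_2 := \row_i [:: s; t]`_i.
(* A scaling that brings any [w] into the open disc. *)
pose c := (1 + dotv w w)^-1.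
have w0 : 0 < 1 + dotv w w by rewrite ltr_pwDl // dotv_ge0.
have c0 : 0 < c by rewrite invr_gt0.
have cw : dotv (c *: w) (c *: w) < 1.
  have -> : dotv (c *: w) (c *: w) = c ^+ 2 * dotv w w.
    by rewrite !dotv2 !mxE; ring.
  rewrite /c exprVn mulrC ltr_pdivrMr ?exprn_gt0 //.
  by have := dotv_ge0 w; nra.
rewrite -(pmulr_rle0 _ (exprn_gt0 2 c0)); apply: le_trans (Hle0 _ cw).
rewrite le_eqVlt; apply/orP; left; apply/eqP.
by rewrite !sum_ord2 !mxE /=; ring.
Qed.

Section SphereFunction.
Variables (R : realType) (v : sphere R -> R).
Implicit Types (x y w : 'rV[R]_2) (A Q : orthogonal_mx R).

Local Notation lu Q := (local_expr (M := sphere R) v Q).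

(** Parametrizations are total functions on the plane, so this holds beyond the discs, wherever the
    point is not the antipode of the centre of [Q]. *)
Lemma local_expr_mul A Q y : 1 + (stereo y *m val A) ord0 ord_max != 0 ->
  lu (orthogonal_mul A Q) y = lu Q (transition A y).
Proof.
move=> h; rewrite /local_expr /=; congr (v _); apply: val_inj => /=.
rewrite /hemisphere_fun /= mulmxA stereo_invK //.
exact: hemisphere_subproof A y.
Qed.

(** Every value of a local expression is a value at the centre of some chart, so maximizing over
    centres is enough. *)
Lemma local_expr_frame Q x : lu (orthogonal_mul (frame x) Q) 0 = lu Q x.
Proof.
rewrite local_expr_mul ?transition0_frame //.
rewrite stereo0_frame stereoE mxE /= addrC subrK.
by rewrite mulf_neq0 ?pnatr_eq0 // invr_neq0 // stereo_den_neq0.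
Qed.

Hypothesis v_smooth : smooth v.

Lemma differentiable_local_expr Q x : open_disc x -> differentiable (lu Q) x.
Proof. exact: (v_smooth (c := Q) [::]). Qed.

Lemma differentiable_pderiv_local_expr Q i x :
  open_disc x -> differentiable (pderiv i (lu Q)) x.
Proof. exact: (v_smooth (c := Q) [:: i]). Qed.

Lemma open_disc0 : open_disc (0 : 'rV[R]_2).
Proof. by rewrite /open_disc /= dotv0. Qed.

(** The chain rule for [lu Q \o transition A], which agrees with the local expression near 0. *)
Lemma pderiv_local_expr_mul A Q : 1 + val A ord_max ord_max != 0 ->
  open_disc (transition A 0) ->
  pderiv ord0 (lu (orthogonal_mul A Q)) 0 =
    \sum_(i < 2) pderiv i (lu Q) (transition A 0) * dtransition (val A) i.
Proof.
move=> h disc.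
have h0 : 1 + (stereo 0 *m val A) ord0 ord_max != 0.
  by rewrite stereo0_mul mxE.
have e : \forall y \near (0 : 'rV[R]_2),
    lu (orthogonal_mul A Q) y = (lu Q \o transition A) y.
  by apply: filterS (near_den h0) => y; exact: local_expr_mul.
have dt := differentiable_transition h0.
have dl := differentiable_local_expr Q disc.
rewrite {1}/pderiv (near_eq_derive _ e).
rewrite deriveE; last exact: differentiable_comp.
rewrite diff_comp //= diff_pderiv //; apply: eq_bigr => i _; congr (_ * _).
have [_ <-] := is_derive_transition i h.
rewrite -deriveE // derive_mx ?mxE //; exact: diff_derivable.
Qed.

Lemma pderiv_local_expr_frame Q x : open_disc x ->
  pderiv ord0 (lu (orthogonal_mul (frame x) Q)) 0 =
    (1 + dotv x x) * pderiv ord0 (lu Q) x.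
Proof.
move=> disc; rewrite pderiv_local_expr_mul ?transition0_frame //.
  rewrite sum_ord2 !dtransition_frame /= mulr0 mulr0 addr0 mulr1; exact: mulrC.
rewrite mxE /= addrC subrK.
by rewrite mulf_neq0 ?pnatr_eq0 // invr_neq0 // stereo_den_neq0.
Qed.

(** * Maxima over the orthogonal group *)

Lemma cvg_stereo_inv_row (M0 : 'M[R]_3) : 1 + M0 ord_max ord_max != 0 ->
  (fun M : 'M[R]_3 => stereo_inv (row ord_max M)) @ M0 -->
    stereo_inv (row ord_max M0).
Proof.
move=> h; apply: (cvg_mx (F := nbhs M0)) => i j.
under eq_cvg do rewrite !mxE; rewrite !mxE.
apply: (@cvgM _ _ (nbhs M0)); first exact: coord_continuous.
apply: cvgV => //; apply: (@cvgD _ _ _ (nbhs M0)); first exact: cvg_cst.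
exact: coord_continuous.
Qed.

Lemma cvg_dtransition (M0 : 'M[R]_3) i : 1 + M0 ord_max ord_max != 0 ->
  (fun M : 'M[R]_3 => dtransition M i) @ M0 --> dtransition M0 i.
Proof.
have c j k : (fun M : 'M[R]_3 => M j k) @ M0 --> M0 j k.
  exact: coord_continuous.
move=> h.
have d : (fun M : 'M[R]_3 => 1 + M ord_max ord_max) @ M0 -->
    1 + M0 ord_max ord_max.
  by apply: (@cvgD _ _ _ (nbhs M0)); [exact: cvg_cst | exact: c].
apply: (@cvgM _ _ (nbhs M0)); first exact: cvg_cst.
apply: (@cvgB _ _ _ (nbhs M0)).
  by apply: (@cvgM _ _ (nbhs M0)); [exact: c | exact: cvgV].
apply: (@cvgM _ _ (nbhs M0)); first by apply: cvgM; exact: c.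
apply: cvgV; first by rewrite expf_neq0.
by under eq_cvg do rewrite expr2; rewrite expr2; exact: cvgM.
Qed.

(** For orthogonal [A] near 1, the centre of [orthogonal_mul A Q] stays in the open hemisphere of
    [Q]. *)
Lemma near_one_gt0 : \forall M \near (1%:M : 'M[R]_3),
  0 < (M : 'M[R]_3) ord_max ord_max.
Proof.
have c : (fun M : 'M[R]_3 => M ord_max ord_max) @ (1%:M : 'M[R]_3) --> (1 : R).
  rewrite -[X in _ --> X](_ : (1%:M : 'M[R]_3) ord_max ord_max = 1).
    exact: coord_continuous.
  by rewrite mxE.
exact: cvgr_gt c _ ltr01.
Qed.

Let den1 : 1 + (1%:M : 'M[R]_3) ord_max ord_max != 0.
Proof. by rewrite mxE /= -mulr2n pnatr_eq0. Qed.

Let stereo_inv_row1 : stereo_inv (row ord_max (1%:M : 'M[R]_3)) = 0.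
Proof. by rewrite row1 -stereo0 stereoK. Qed.

Lemma exists_max_local_expr :
  exists Q, forall x, lu Q x <= lu Q 0.
Proof.
have [Q|Q Qmax] := @orthogonal_max R (fun Q => lu Q 0); last first.
  by exists Q => x; rewrite -local_expr_frame.
exists (fun M => lu Q (stereo_inv (row ord_max M))).
  have := cvg_stereo_inv_row den1; rewrite stereo_inv_row1 => c.
  apply: (cvg_comp _ _ c); rewrite stereo_inv_row1.
  exact/differentiable_continuous/differentiable_local_expr/open_disc0.
apply: filterS near_one_gt0 => M M0 A AM; rewrite -AM -transition0.
apply: local_expr_mul; rewrite stereo0_mul mxE AM.
by rewrite lt0r_neq0 // ltr_wpDl.
Qed.

Lemma exists_max_pderiv : exists Q, forall A,
  pderiv ord0 (lu A) 0 <= pderiv ord0 (lu Q) 0.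
Proof.
apply: (@orthogonal_max R (fun Q => pderiv ord0 (lu Q) 0)) => Q.
(* The chain rule expresses the derivative in the moving chart by the partial derivatives in the
   fixed chart [Q], which are continuous at its centre. *)
exists (fun M => \sum_(i < 2)
    pderiv i (lu Q) (stereo_inv (row ord_max M)) * dtransition M i).
  apply: (@cvg_big _ _ _ _ _ _ _ (nbhs (1%:M : 'M[R]_3))) => [|i _].
    exact: add_continuous.
  apply: (@cvgM _ _ (nbhs (1%:M : 'M[R]_3)) _
    (fun M => pderiv i (lu Q) (stereo_inv (row ord_max M)))
    (fun M => dtransition M i));
    last exact: cvg_dtransition.
  have := cvg_stereo_inv_row den1; rewrite stereo_inv_row1 => c.
  apply: (cvg_comp _ _ c).
  apply: differentiable_continuous.
  exact/differentiable_pderiv_local_expr/open_disc0.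
apply: filterS near_one_gt0 => M M0 A AM; rewrite -AM -transition0.
apply: pderiv_local_expr_mul; last by apply: transition0_disc; rewrite AM.
by rewrite AM lt0r_neq0 // ltr_wpDl.
Qed.

(** * First and second derivatives at the maxima *)

Lemma is_derive_axis i (f : 'rV[R]_2 -> R) (t : R) :
  differentiable f (t *: delta_mx ord0 i) ->
  is_derive t 1 (fun s : R => f (s *: delta_mx ord0 i))
    (pderiv i f (t *: delta_mx ord0 i)).
Proof.
by move=> h; apply: is_derive_ray; exact/derivableP/diff_derivable.
Qed.

Lemma dotv_axis i (t : R) :
  dotv (t *: delta_mx ord0 i : 'rV[R]_2) (t *: delta_mx ord0 i) = t ^+ 2.
Proof.
by rewrite dotv2 !mxE; move: i; apply: ord2P; rewrite /=; ring.
Qed.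

Lemma open_disc_axis i (t : R) : t \in `]-1, 1[ ->
  open_disc (t *: delta_mx ord0 i : 'rV[R]_2).
Proof.
by rewrite in_itv /= /open_disc /= dotv_axis => /andP[? ?]; nra.
Qed.

Let in0 : (0 : R) \in `]-1, 1[.
Proof. by rewrite in_itv /= ltrN10 ltr01. Qed.

(** Recentring the chart at [t *: e], for [e] the i-th axis vector, turns its first partial
    derivative at the centre into [k t = (1 + t ^+ 2) * P (t *: e)], which is maximal at [t = 0].
    The factor has zero derivative there, so [k' 0 = 0] is the claim. *)
Lemma pderiv2_at_max Q :
  (forall A, pderiv ord0 (lu A) 0 <= pderiv ord0 (lu Q) 0) ->
  forall i, pderiv i (pderiv ord0 (lu Q)) 0 = 0.
Proof.
move=> Qmax i; set P := pderiv ord0 (lu Q); set e := delta_mx ord0 i : 'rV[R]_2.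
pose k : R -> R := (cst 1 + id * id) * (fun s => P (s *: e)).
have dk (t : R) : t \in `]-1, 1[ ->
    is_derive t 1 k ((1 + t ^+ 2) * pderiv i P (t *: e) + 2 * t * P (t *: e)).
  move=> /(@open_disc_axis i)/(@differentiable_pderiv_local_expr Q ord0) h.
  have := is_derive_axis h; rewrite -/e -/P => dP.
  have did := is_derive_id t 1.
  have d := is_deriveM (is_deriveD (is_derive_cst (1 : R) t 1)
    (is_deriveM did did)) dP.
  refine (is_derive_eq d _).
  rewrite /GRing.scale !fctE /=.
  by move: (P _) (pderiv _ _ _) => p p'; ring.
have kE (t : R) : t \in `]-1, 1[ ->
    k t = pderiv ord0 (lu (orthogonal_mul (frame (t *: e)) Q)) 0.
  move=> /(@open_disc_axis i) h; rewrite pderiv_local_expr_frame // dotv_axis.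
  by rewrite /k !fctE /= expr2.
have k0 : k 0 = P 0 by rewrite /k !fctE /= scale0r; ring.
have : is_derive (0 : R) 1 k 0.
  apply: (@derive1_at_max R k (-1) 1 0) => [|t /dk[]//|//|t ht]; first lra.
  by rewrite k0 kE.
case=> _; have [_ ->] := dk _ in0.
by rewrite scale0r expr0n /= mulr0 mul0r !addr0 mul1r.
Qed.

Lemma pderiv_at_max Q : (forall x, lu Q x <= lu Q 0) ->
  forall i, pderiv i (lu Q) 0 = 0.
Proof.
move=> Qmax i; set e := delta_mx ord0 i : 'rV[R]_2.
have dk (t : R) : t \in `]-1, 1[ ->
    is_derive t 1 (fun s : R => lu Q (s *: e)) (pderiv i (lu Q) (t *: e)).
  by move=> /(@open_disc_axis i)/(@differentiable_local_expr Q)/is_derive_axis.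
have : is_derive (0 : R) 1 (fun s : R => lu Q (s *: e)) 0.
  apply: (@derive1_at_max R _ (-1) 1 0) => [|t /dk[]//|//|t ht]; first lra.
  by rewrite scale0r.
by case=> _; have [_ ->] := dk _ in0; rewrite scale0r.
Qed.

(** The sum is the second derivative at 0 of [t |-> lu Q (t *: w)]. Taking [w] in the disc keeps
    [t *: w] in the chart domain for [|t| < 1]. *)
Lemma hessian_quadratic_le0 Q :
  (forall x, lu Q x <= lu Q 0) -> forall w, dotv w w < 1 ->
  \sum_(i < 2) (\sum_(j < 2) pderiv j (pderiv i (lu Q)) 0 * w ord0 j) * w ord0 i
    <= 0.
Proof.
move=> Qmax w w1.
have disc (t : R) : t \in `]-1, 1[ -> open_disc (t *: w).
  rewrite in_itv /= /open_disc /= => /andP[t0 t1].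
  have -> : dotv (t *: w) (t *: w) = t ^+ 2 * dotv w w.
    by rewrite !dotv2 !mxE; ring.
  by have := dotv_ge0 w; nra.
apply: (@second_derivative_le0 R (fun t => lu Q (t *: w))
  (fun t => \sum_(i < 2) pderiv i (lu Q) (t *: w) * w ord0 i)).
- move=> t /disc h; apply: is_derive_ray.
  have d := differentiable_local_expr Q h.
  by apply: DeriveDef; [exact: diff_derivable | rewrite deriveE // diff_pderiv].
- by move=> t _; rewrite scale0r.
- rewrite [X in is_derive _ _ X _](_ : _ = \sum_(i < 2)
    (fun t : R => pderiv i (lu Q) (t *: w)) * cst (w ord0 i)); last first.
    by apply/funext => t; rewrite fct_sumE.
  apply: is_derive_sum => i.
  have d : is_derive (0 : R) 1 (fun t : R => pderiv i (lu Q) (t *: w))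
      (\sum_(j < 2) pderiv j (pderiv i (lu Q)) 0 * w ord0 j).
    have h := differentiable_pderiv_local_expr Q i open_disc0.
    apply: is_derive_ray; rewrite scale0r.
    apply: DeriveDef; first exact: diff_derivable.
    by rewrite deriveE // diff_pderiv.
  by apply: is_derive_eq; rewrite scaler0 add0r [_ *: _]mulrC.
Qed.

Lemma hessian_det_ge0_at_max Q : (forall x, lu Q x <= lu Q 0) ->
  0 <= pderiv ord0 (pderiv ord0 (lu Q)) 0
         * pderiv ord_max (pderiv ord_max (lu Q)) 0
       - pderiv ord0 (pderiv ord_max (lu Q)) 0
         * pderiv ord_max (pderiv ord0 (lu Q)) 0.
Proof.
move=> Qmax.
apply: (nsd_disc_det_ge0 (H := fun i j => pderiv i (pderiv j (lu Q)) 0)).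
exact: hessian_quadratic_le0.
Qed.

End SphereFunction.

(** * Rigidity *)

Lemma det_mx22 (R : comPzRingType) (A : 'M[R]_2) :
  \det A = A ord0 ord0 * A ord_max ord_max - A ord0 ord_max * A ord_max ord0.
Proof.
rewrite (expand_det_row A ord0) sum_ord2 /cofactor !det_mx11 !mxE /=.
have -> : lift ord0 (0 : 'I_1) = ord_max :> 'I_2 by exact: val_inj.
have -> : lift ord_max (0 : 'I_1) = ord0 :> 'I_2 by exact: val_inj.
by rewrite expr0 expr1; ring.
Qed.

Section Rigidity.
Variables (R : realType) (v : sphere R -> R).
Implicit Types (x y w : 'rV[R]_2) (A Q : orthogonal_mx R).

Local Notation lu Q := (local_expr (M := sphere R) v Q).
Local Notation half_frame := ((2^-1)%:M : 'M[R]_2).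

Lemma metric0 Q : metric (s := sphere R) Q 0 = 4%:M.
Proof.
by rewrite /= induced_metricE dotv0 addr0 divr1; congr (_%:M); ring.
Qed.

Lemma orthonormal_frame0 Q : orthonormal_frame (M := sphere R) Q 0 half_frame.
Proof.
rewrite /orthonormal_frame metric0 tr_scalar_mx -!scalar_mxM.
by congr (_%:M); field.
Qed.

Lemma grad_sqr0 Q : grad_sqr (M := sphere R) v Q 0 =
  (pderiv ord0 (lu Q) 0 ^+ 2 + pderiv ord_max (lu Q) 0 ^+ 2) / 4.
Proof.
rewrite /grad_sqr /inner /grad metric0 invmx_scalar !mul_mx_scalar.
rewrite mxE sum_ord2 !mxE.
by move: (pderiv ord0 _ _) (pderiv ord_max _ _) => a b; field.
Qed.

Lemma christoffel0 Q k i j : christoffel (M := sphere R) Q 0 k i j = 0.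
Proof.
rewrite /christoffel big1 ?mulr0 // => l _.
by rewrite !(pderiv_metric0 Q) subr0 addr0 mulr0.
Qed.

Lemma hessian0 Q i j :
  hessian (M := sphere R) v Q 0 i j = pderiv i (pderiv j (lu Q)) 0.
Proof.
by rewrite mxE big1 ?subr0 // => k _; rewrite christoffel0 mul0r.
Qed.

Lemma det_hessian_in0 Q : \det (hessian_in (M := sphere R) v Q 0 half_frame) =
  (pderiv ord0 (pderiv ord0 (lu Q)) 0
     * pderiv ord_max (pderiv ord_max (lu Q)) 0
   - pderiv ord0 (pderiv ord_max (lu Q)) 0
     * pderiv ord_max (pderiv ord0 (lu Q)) 0) / 16.
Proof.
rewrite /hessian_in !det_mulmx tr_scalar_mx !det_scalar det_mx22 !hessian0.
by set d := (X in _ * X * _ = _); rewrite -/d; move: d => d; field.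
Qed.

Hypothesis v_smooth : smooth v.

(* Rotating a chart about its centre turns the first partial derivative at the
   centre into any directional derivative. *)
Definition rotation_mx (a b : R) : 'M[R]_3 :=
  \matrix_(i < 3, j < 3)
    (nth [::] [:: [:: a; b; 0]; [:: - b; a; 0]; [:: 0; 0; 1]] i)`_j.

Lemma rotation_subproof (a b : R) : a ^+ 2 + b ^+ 2 = 1 ->
  rotation_mx a b *m (rotation_mx a b)^T == 1%:M.
Proof.
move=> h.
apply/eqP/matrixP => i j; move: i; apply: ord3P; move: j; apply: ord3P;
  rewrite !mxE !sum_ord3 !mxE /= ?mulr1n; (ring || rewrite -[RHS]h; ring).
Qed.

Definition rotation a b (h : a ^+ 2 + b ^+ 2 = 1) : orthogonal_mx R :=
  exist _ (rotation_mx a b) (rotation_subproof h).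

Lemma pderiv_local_expr_rotation a b (h : a ^+ 2 + b ^+ 2 = 1) Q :
  pderiv ord0 (lu (orthogonal_mul (rotation h) Q)) 0 =
    a * pderiv ord0 (lu Q) 0 + b * pderiv ord_max (lu Q) 0.
Proof.
have t0 : transition (rotation h) 0 = 0.
  rewrite transition0 -[RHS]stereoK stereo0; congr stereo_inv.
  by apply/rowP; apply: ord3P; rewrite !mxE.
have r i : dtransition (rotation_mx a b) i = [:: a; b]`_i.
  by rewrite /dtransition !mxE; move: i; apply: ord2P; rewrite /=; field.
rewrite pderiv_local_expr_mul //; last by rewrite t0; exact: open_disc0.
  by rewrite t0 sum_ord2 !r mulrC; congr (_ + _); exact: mulrC.
by rewrite mxE /= -mulr2n pnatr_eq0.
Qed.

Lemma pderiv_eq0_of_max Q0 :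
  (forall A, pderiv ord0 (lu A) 0 <= pderiv ord0 (lu Q0) 0) ->
  pderiv ord0 (lu Q0) 0 = 0 -> forall Q i, pderiv i (lu Q) 0 = 0.
Proof.
move=> Q0max Q00.
have P0 Q : pderiv ord0 (lu Q) 0 = 0.
  (* A half turn changes the sign of the derivative, so both it and its opposite are at most 0. *)
  have h : (-1) ^+ 2 + 0 ^+ 2 = 1 :> R by ring.
  have := Q0max Q; have := Q0max (orthogonal_mul (rotation h) Q).
  rewrite pderiv_local_expr_rotation Q00 mul0r addr0 mulN1r oppr_le0 => p0 p1.
  by apply/eqP; rewrite eq_le p1.
move=> Q i; move: i; apply: ord2P => //.
(* A quarter turn makes the second partial derivative a first one. *)
have h : 0 ^+ 2 + 1 ^+ 2 = 1 :> R by ring.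
have := P0 (orthogonal_mul (rotation h) Q).
by rewrite pderiv_local_expr_rotation mul0r add0r mul1r.
Qed.

(** * Functions with vanishing gradient are constant *)

Section ZeroGradient.
Hypothesis pderiv0 : forall Q i, pderiv i (lu Q) 0 = 0.

(** Near [x] the function factors through the chart [Q'] centred at the point of coordinates [x],
    where the differential vanishes. Here [x] ranges over the whole plane, so a single chart reaches
    all points but one. *)
Lemma is_derive_local_expr0 Q x w : is_derive x w (lu Q) 0.
Proof.
set A := orthogonal_tr (frame x); set Q' := orthogonal_mul (frame x) Q.
have xA : stereo x *m val A = stereo 0.
  by rewrite -stereo0_frame -mulmxA (eqP (valP (frame x))) mulmx1.
have h : 1 + (stereo x *m val A) ord0 ord_max != 0.
  by rewrite xA stereo0 mxE /= -mulr2n pnatr_eq0.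
have tx : transition A x = 0 by rewrite /transition xA stereoK.
have dt := differentiable_transition h.
have dl : differentiable (lu Q') (transition A x).
  by rewrite tx; apply: differentiable_local_expr => //; exact: open_disc0.
have e : \forall y \near x, (lu Q' \o transition A) y = lu Q y.
  apply: filterS (near_den h) => y hy.
  by rewrite -[in RHS](orthogonal_trK (frame x) Q) local_expr_mul.
apply: near_eq_is_derive e _; apply: DeriveDef.
  exact/diff_derivable/differentiable_comp.
rewrite deriveE; last exact: differentiable_comp.
rewrite diff_comp //= diff_pderiv // big1 // => i _.
by rewrite tx pderiv0 mul0r.
Qed.

Lemma local_expr_cst Q x : lu Q x = lu Q 0.
Proof.
rewrite -[x in LHS]scale1r -[0 in RHS](scale0r x).
apply: (@is_derive_0_is_cst R (fun t => lu Q (t *: x))) => t.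
exact/is_derive_ray/is_derive_local_expr0.
Qed.

Lemma value_local_expr Q (p : sphere R) :
  1 + (val p *m (val Q)^T) ord0 ord_max != 0 -> v p = lu Q 0.
Proof.
move=> h; rewrite -(local_expr_cst Q (stereo_inv (val p *m (val Q)^T))).
rewrite /local_expr /=; congr (v _); apply: val_inj => /=.
rewrite /hemisphere_fun stereo_invK //.
  by rewrite -mulmxA mulTmx_orthogonal mulmx1.
have := dotv_orthogonal (orthogonal_tr Q) (val p) (val p) => /= ->.
exact: (valP p).
Qed.

(** The charts [I] and [N] have opposite centres, so each covers the point that the other misses;
    their constants are compared at the common point [e]. *)
Lemma zero_gradient_cst (p q : sphere R) : v p = v q.
Proof.
have o1 : (1%:M : 'M[R]_3) *m 1%:M^T == 1%:M by rewrite trmx1 mulmx1.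
have oN : (- 1%:M : 'M[R]_3) *m (- 1%:M)^T == 1%:M.
  by rewrite linearN /= trmx1 mulNmx mulmxN opprK mulmx1.
pose I : orthogonal_mx R := exist _ 1%:M o1.
pose N : orthogonal_mx R := exist _ (- 1%:M) oN.
have NI : lu N 0 = lu I 0.
  have e1 : dotv (delta_mx ord0 ord0 : 'rV[R]_3) (delta_mx ord0 ord0) == 1.
    by apply/eqP; rewrite dotv3 !mxE /=; ring.
  pose e : sphere R := exist _ (delta_mx ord0 ord0) e1.
  rewrite -(@value_local_expr N e) ?(@value_local_expr I e) //=.
    by rewrite trmx1 mulmx1 mxE /= addr0 oner_neq0.
  by rewrite linearN /= trmx1 mulmxN mulmx1 !mxE /= oppr0 addr0 oner_neq0.
suff vI s : v s = lu I 0 by rewrite !vI.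
have [h|h] := eqVneq (1 + val s ord0 ord_max) 0.
  rewrite -NI; apply: value_local_expr.
  rewrite /= linearN /= trmx1 mulmxN mulmx1 mxE.
  move: h => /eqP; rewrite addrC addr_eq0 => /eqP ->.
  by rewrite opprK -mulr2n pnatr_eq0.
by apply: value_local_expr; rewrite /= trmx1 mulmx1.
Qed.

End ZeroGradient.

Lemma exists_max_det_ge0 : exists Q,
  grad_sqr (M := sphere R) v Q 0 = 0 /\
  0 <= \det (hessian_in (M := sphere R) v Q 0 half_frame).
Proof.
have [Q Qmax] := exists_max_local_expr v_smooth; exists Q; split.
  by rewrite grad_sqr0 !(pderiv_at_max v_smooth Qmax) expr0n /= addr0 mul0r.
by rewrite det_hessian_in0 divr_ge0 //; exact: hessian_det_ge0_at_max.
Qed.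

(** At a maximum of the directional derivative one column of second derivatives vanishes. If the
    gradient is zero there, the maximal directional derivative is 0, hence all of them are. *)
Lemma exists_det_eq0 : exists Q,
  [/\ 0 <= grad_sqr (M := sphere R) v Q 0,
      \det (hessian_in (M := sphere R) v Q 0 half_frame) = 0 &
      grad_sqr (M := sphere R) v Q 0 = 0 -> forall p q, v p = v q].
Proof.
have [Q Qmax] := exists_max_pderiv v_smooth; exists Q.
have g2 i : 0 <= pderiv i (lu Q) 0 ^+ 2 by exact: sqr_ge0.
split.
- by rewrite grad_sqr0 divr_ge0 // addr_ge0.
- rewrite det_hessian_in0 (pderiv2_at_max v_smooth Qmax ord0).
  rewrite (pderiv2_at_max v_smooth Qmax ord_max).
  by rewrite mul0r mulr0 subr0 mul0r.
rewrite grad_sqr0 => /eqP; rewrite mulf_eq0 invr_eq0 pnatr_eq0 orbF.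
rewrite (paddr_eq0 (g2 _) (g2 _)) !sqrf_eq0 => /andP[/eqP h _].
by apply: zero_gradient_cst; exact: pderiv_eq0_of_max h.
Qed.

End Rigidity.

(** * Constant functions solve both equations for K = 1 *)

Section Constant.
Variables (R : realType) (M : surface R) (u : M -> R) (a : R).
Hypothesis ua : forall p, u p = a.

Lemma pderiv_cst i (b : R) : pderiv i (cst b : 'rV[R]_2 -> R) = cst 0.
Proof. by apply/funext => x; rewrite /pderiv derive_cst. Qed.

Lemma local_expr_of_cst c : local_expr u c = cst a.
Proof. by apply/funext => x; rewrite /local_expr ua. Qed.

Lemma smooth_of_cst : smooth u.
Proof.
move=> c s x _; rewrite local_expr_of_cst.
suff [b ->] : exists b : R,
    foldr (fun i g => pderiv i g) (cst a : 'rV[R]_2 -> R) s = cst b.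
  exact: differentiable_cst.
elim: s => [|i s [b /= ->]]; first by exists a.
by exists 0; exact: pderiv_cst.
Qed.

Lemma grad_sqr_of_cst c x : grad_sqr u c x = 0.
Proof.
rewrite /grad_sqr (_ : grad u c x = 0) ?/inner ?mul0mx ?mxE //.
rewrite /grad (_ : \row_i _ = 0) ?mul0mx //.
by apply/rowP => i; rewrite !mxE local_expr_of_cst pderiv_cst.
Qed.

Lemma det_hessian_in_of_cst c x E : \det (hessian_in u c x E) = 0.
Proof.
rewrite /hessian_in (_ : hessian u c x = 0) ?mulmx0 ?mul0mx ?det0 //.
apply/matrixP => i j; rewrite !mxE !local_expr_of_cst !pderiv_cst /= sub0r.
by rewrite big1 ?oppr0 // => k _; rewrite pderiv_cst mulr0.
Qed.

Lemma entire_solution_plus_of_cst : entire_solution_plus 1 u.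
Proof.
split=> [|c x _ E _]; first exact: smooth_of_cst.
by rewrite grad_sqr_of_cst det_hessian_in_of_cst !addr0 expr1n mulr1.
Qed.

Lemma entire_solution_minus_of_cst : entire_solution_minus 1 u.
Proof.
split=> [|c x _]; first exact: smooth_of_cst.
split=> [|E _]; first by rewrite grad_sqr_of_cst ltr01.
by rewrite grad_sqr_of_cst det_hessian_in_of_cst !subr0 expr1n mulr1.
Qed.

End Constant.

(** * Entire solutions on the sphere and the projective plane *)

Lemma sphere_solution_plus (R : realType) (v : sphere R -> R) (K : R) :
  entire_solution_plus K v -> (forall p q, v p = v q) /\ K = 1.
Proof.
move=> [v_smooth eqv].
have eq0 Q := eqv Q 0 (open_disc0 R) _ (orthonormal_frame0 Q).
have [Q [g0 d0]] := exists_max_det_ge0 v_smooth.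
have K1 : 1 <= K.
  have := eq0 Q; rewrite g0 !addr0 expr1n mul1r => ->.
  by rewrite lerDl.
have [Q' [g1 d1 cst_v]] := exists_det_eq0 v_smooth.
have := eq0 Q'; rewrite d1 addr0.
move: (grad_sqr _ _ _) g1 cst_v => g g1 cst_v e.
have e1 : (1 + g) * K = 1.
  apply: (@mulfI _ (1 + g)); first by rewrite lt0r_neq0 // ltr_wpDr.
  by rewrite mulr1 -[RHS]e; ring.
(* With [K + g * K = 1] and [1 <= K] this gives [g <= 0]. *)
have gK : g <= g * K by rewrite ler_peMr.
have g00 : g = 0 by apply/eqP; rewrite eq_le g1 andbT; lra.
by split; [exact: cst_v | move: e1; rewrite g00 addr0 mul1r].
Qed.

Lemma sphere_solution_minus (R : realType) (v : sphere R -> R) (K : R) :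
  entire_solution_minus K v -> (forall p q, v p = v q) /\ K = 1.
Proof.
move=> [v_smooth eqv].
have eq0 Q := (eqv Q 0 (open_disc0 R)).2 _ (orthonormal_frame0 Q).
have [Q [g0 d0]] := exists_max_det_ge0 v_smooth.
have K1 : K <= 1.
  have := eq0 Q; rewrite g0 !subr0 expr1n mul1r => ->.
  by rewrite gerBl.
have [Q' [g1 d1 cst_v]] := exists_det_eq0 v_smooth.
have := (eqv Q' 0 (open_disc0 R)).1.
have := eq0 Q'; rewrite d1 subr0.
move: (grad_sqr _ _ _) g1 cst_v => g g1 cst_v e lt1.
(* The bound [g < 1] allows the division by [1 - g]. *)
have e1 : (1 - g) * K = 1.
  apply: (@mulfI _ (1 - g)); first by rewrite lt0r_neq0 // subr_gt0.
  by rewrite mulr1 -[RHS]e; ring.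
have gK : (1 - g) * K <= 1 - g by rewrite ler_piMr // ltW // subr_gt0.
have g00 : g = 0 by apply/eqP; rewrite eq_le g1 andbT; lra.
by split; [exact: cst_v | move: e1; rewrite g00 subr0 mul1r].
Qed.

Lemma to_projective_surj (R : realType) (p : projective_point R) :
  exists q, to_projective q = p.
Proof. by exists (repr p); exact: reprK. Qed.

Theorem corollary10 (R : realType) (M : surface R)
    (hM : M = sphere R \/ M = projective_plane R) (K : R) :
  (forall u : M -> R,
     entire_solution_plus K u <-> (exists a : R, forall p : M, u p = a) /\ K = 1)
  /\
  (forall u : M -> R,
     entire_solution_minus K u <-> (exists a : R, forall p : M, u p = a) /\ K = 1)
  /\
  (K <> 1 ->
     ~ (exists u : M -> R, entire_solution_plus K u) /\
     ~ (exists u : M -> R, entire_solution_minus K u)).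
Proof.
pose p0 : sphere_point R := exist _ (stereo 0) (dotv_stereo 0).
have plus (u : M -> R) : entire_solution_plus K u ->
    (exists a : R, forall p : M, u p = a) /\ K = 1.
  case: hM u => -> u.
    move=> /sphere_solution_plus[uc K1]; split=> //.
    by exists (u p0) => p; exact: uc.
  (* The two surfaces share chart domains and metrics, and the local expressions of the pullback are
     those of [u], so the hypothesis on [u] is by conversion one on the sphere. *)
  move=> /(@sphere_solution_plus R (u \o @to_projective R))[uc K1]; split=> //.
  exists (u (to_projective p0)) => p.
  by have [q <-] := to_projective_surj p; exact: uc.
have minus (u : M -> R) : entire_solution_minus K u ->
    (exists a : R, forall p : M, u p = a) /\ K = 1.
  case: hM u => -> u.
    move=> /sphere_solution_minus[uc K1]; split=> //.
    by exists (u p0) => p; exact: uc.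
  move=> /(@sphere_solution_minus R (u \o @to_projective R))[uc K1]; split=> //.
  exists (u (to_projective p0)) => p.
  by have [q <-] := to_projective_surj p; exact: uc.
split; [|split].
- move=> u; split=> [/plus//|[[a ua] ->]].
  exact: entire_solution_plus_of_cst ua.
- move=> u; split=> [/minus//|[[a ua] ->]].
  exact: entire_solution_minus_of_cst ua.
by move=> K1; split=> -[u]; [move=> /plus[_] | move=> /minus[_]].
Qed.
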